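(* Let $(W,S)$ and $(W',S')$ be finite Coxeter systems, let $\eta:W\to W'$ be a surjective lattice homomorphism between the weak orders, and let $J=\{s\in S:\eta(s)\neq 1'\}$, where $1'$ is the identity element of $W'$. Then $\eta$ factors as $\eta=\eta|_{W_J}\circ\eta_J$, where $\eta_J:W\to W_J$ is the parabolic homomorphism and $\eta|_{W_J}$ is the restriction of $\eta$ to $W_J$. The map $\eta|_{W_J}:W_J\to W'$ is a compressive homomorphism.
   Context: For a finite Coxeter system $(W,S)$ with length function $\ell$, the (right) weak order on $W$ is the lattice whose cover relations are $w\lessdot ws$ for $w\in W$, $s\in S$ with $\ell(w)<\ell(ws)$. A lattice homomorphism preserves pairwise meets and joins. For $J\subseteq S$, $W_J$ is the standard parabolic subgroup generated by $J$, with its own weak order (it is a lower interval in $W$). Every $w\in W$ has a unique factorization $w=w_J\cdot {}^Jw$ maximizing $\ell(w_J)$ subject to $\ell(w_J)+\ell({}^Jw)=\ell(w)$ and $w_J\in W_J$; the parabolic homomorphism is the map $\eta_J:W\to W_J$, $w\mapsto w_J$. An atom of a finite lattice is an element covering the minimum element (the atoms of the weak order on $W$ are the elements of $S$). A homomorphism of finite lattices is compressive if it is surjective and restricts to a bijection between the sets of atoms of the two lattices. *)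

(* Defs.v *)
From mathcomp Require Import all_boot all_fingroup.

Set Implicit Arguments.
Unset Strict Implicit.
Unset Printing Implicit Defensive.

Local Open Scope group_scope.

(* W = < S | (s t)^m(s,t) = 1 >.  The entry m s t = 0 encodes m(s,t) = oo: the
   corresponding relation is then vacuous because x ^+ 0 = 1.  The presentation
   is expressed by its universal property among all (possibly infinite) groups;
   uniqueness of phi on W follows from <<S>> = W. *)
Definition coxeter_matrix (T : finType) (S : {set T}) (m : T -> T -> nat) : Prop :=
  {in S &, forall s t, m s t = m t s} /\
  {in S &, forall s t, (m s t == 1%N) = (s == t)}.

Definition coxeter_system (gT : finGroupType) (W : {group gT}) (S : {set gT}) : Prop :=
  exists m : gT -> gT -> nat,
  [/\ coxeter_matrix S m,
      <<S>> = W,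
      {in S &, forall s t, (s * t) ^+ m s t = 1}
    & forall (H : groupType) (f : gT -> H),
        {in S &, forall s t, (f s * f t) ^+ m s t = 1} ->
        exists phi : gT -> H,
          {in W &, {morph phi : x y / x * y}} /\ {in S, phi =1 f}].

Section WeakOrder.

Variables (gT : finGroupType) (S : {set gT}).

(* [S ^+ k] is the set of all products of k elements of S.  No inverses are
   needed to reach all of <<S>> since gT is finite.  Elements outside <<S>> get
   the junk length 0. *)
Lemma exists_word w : exists k, (w \in S ^+ k) || (w \notin <<S>>).
Proof.
have [/gen_prodgP[n [c Sc ->]]|_] := boolP (w \in <<S>>); last by exists 0%N; rewrite orbT.
exists n; apply/orP; left.
elim: n c Sc => [|n IHn] c Sc; first by rewrite big_ord0 expg0 group1.
by rewrite big_ord_recl expgS mem_mulg ?IHn // => i.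
Qed.

Definition length (w : gT) : nat := ex_minn (exists_word w).

Lemma lengthP w : w \in <<S>> ->
  w \in S ^+ length w /\ forall k, w \in S ^+ k -> length w <= k.
Proof.
rewrite /length => Sw; case: ex_minnP => n; rewrite Sw orbF => Sn min_n.
by split=> // k Sk; apply: min_n; rewrite Sk.
Qed.

Definition weak_cover : rel gT :=
  [rel w v | [exists s in S, v == w * s] && (length w < length v)].

Definition weak_le : rel gT := connect weak_cover.

(* The factor w_J of w = w_J * (w_J^-1 * w). *)
Definition parabolic_map (J : {set gT}) (w : gT) : gT :=
  [arg max_(u > 1 | (u \in <<J>>) && (length u + length (u^-1 * w) == length w))
     length u].

Lemma parabolic_mapP J w (u := parabolic_map J w) :
  [/\ u \in <<J>>, (length u + length (u^-1 * w) = length w)%N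
    & forall v, v \in <<J>> -> (length v + length (v^-1 * w) = length w)%N ->
        length v <= length u].
Proof.
have len1 : length 1 = 0%N.
  by apply/eqP; rewrite -leqn0; apply: (lengthP (group1 _)).2; rewrite expg0 group1.
rewrite /u /parabolic_map; case: arg_maxnP => [|i /andP[Ji /eqP def_w] max_i].
  by rewrite group1 len1 invg1 mul1g eqxx.
by split=> // v Jv /eqP def_v; apply: max_i; rewrite Jv.
Qed.

End WeakOrder.

(* A finite poset is a subset A of a finType with a relation [le] that is an
   order on A; [le] is irrelevant outside A. *)
Section Posets.

Variables (T : finType) (A : {set T}) (le : rel T).

Definition is_meet (x y z : T) : Prop :=
  [/\ z \in A, le z x, le z y & {in A, forall u, le u x -> le u y -> le u z}].

Definition is_join (x y z : T) : Prop :=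
  [/\ z \in A, le x z, le y z & {in A, forall u, le x u -> le y u -> le z u}].

Definition covers (x y : T) : bool :=
  [&& x \in A, y \in A, x != y, le x y
    & [forall z in A, (le x z && le z y) ==> (z == x) || (z == y)]].

Definition is_minimum (b : T) : bool := (b \in A) && [forall x in A, le b x].

Definition atoms : {set T} :=
  [set a in A | [exists b, is_minimum b && covers b a]].

End Posets.

Section Homomorphisms.

Variables (T T' : finType).
Variables (A : {set T}) (le : rel T) (A' : {set T'}) (le' : rel T').

(* Meets and joins are given by their defining property, so this applies to the
   weak orders without first constructing the lattice operations on them. *)
Definition lattice_hom (f : T -> T') : Prop :=
  [/\ {in A, forall x, f x \in A'},
      {in A &, forall x y z,
         is_meet A le x y z -> is_meet A' le' (f x) (f y) (f z)}
    & {in A &, forall x y z,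
         is_join A le x y z -> is_join A' le' (f x) (f y) (f z)}].

Definition surjective_on (f : T -> T') : Prop := f @: A = A'.

Definition compressive (f : T -> T') : Prop :=
  [/\ lattice_hom f, surjective_on f,
      {in atoms A le &, injective f}
    & f @: atoms A le = atoms A' le'].

End Homomorphisms.

(* Main.v *)
(* Let z be the longest element of W_J.  The top element of W is the join of S,
   and eta sends every s outside J to 1, so eta z is the top element of W'.  As
   w_J is the meet of w and z, eta w_J is the meet of eta w and the top of W',
   that is, eta w.  Distinct simple reflections r and s meet in 1, so eta r and
   eta s are incomparable when r and s are distinct elements of J; together with
   surjectivity this gives the bijection between the atoms. *)
Require Import Defs.
From mathcomp Require Import all_boot all_fingroup zify.

Set Implicit Arguments.
Unset Strict Implicit.

Local Open Scope group_scope.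

(* [lia] compares atoms syntactically, whereas the same length may occur with
   different (convertible) paths to the group structure of [gT]. *)
Ltac length_lia :=
  repeat match goal with H : context [@Defs.length _ _ _] |- _ => revert H end;
  repeat match goal with
    |- context [@Defs.length ?T ?S ?x] => move: (@Defs.length T S x) => ? end;
  lia.

Lemma subset_expg (gT : finGroupType) (A B : {set gT}) k :
  A \subset B -> A ^+ k \subset B ^+ k.
Proof. by move=> sAB; elim: k => // k IHk; rewrite !expgS mulgSS. Qed.

(** * Word length and weak order for an arbitrary subset of a finite group *)

Section WordLength.

Variables (gT : finGroupType) (S : {set gT}).

Lemma prod_gen k w : w \in S ^+ k -> w \in <<S>>.
Proof.
elim: k w => [|k IHk] w; first by rewrite expg0 => /set1P->; rewrite group1.
by rewrite expgS => /mulsgP[s v Ss /IHk Sv ->]; rewrite groupM // mem_gen.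
Qed.

Lemma length_min k w : w \in S ^+ k -> length S w <= k.
Proof. by move=> Skw; apply: (lengthP (prod_gen Skw)).2. Qed.

Lemma mem_length w : w \in <<S>> -> w \in S ^+ length S w.
Proof. by case/lengthP. Qed.

Lemma length1 : length S 1 = 0%N.
Proof. by apply/eqP; rewrite -leqn0 length_min // expg0 group1. Qed.

Lemma length_gt0 w : w \in <<S>> -> w != 1 -> 0 < length S w.
Proof.
move=> /mem_length Sw; rewrite lt0n; apply: contra_neq => w0.
by move: Sw; rewrite w0 expg0 => /set1P.
Qed.

Lemma lengthM : {in <<S>> &, forall u v, length S (u * v) <= length S u + length S v}.
Proof. by move=> u v Su Sv; rewrite length_min // expgD mem_mulg ?mem_length. Qed.

Lemma length_gen s : s \in S -> s != 1 -> length S s = 1%N.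
Proof.
move=> Ss s_neq1; apply/eqP; rewrite eqn_leq length_gt0 ?mem_gen //.
by rewrite length_min // expg1.
Qed.

(** Splitting off the first letter of a shortest word leaves a shortest word, by the triangle
    inequality [lengthM]. *)
Lemma length_word_ind (P : gT -> Prop) :
  P 1 ->
  (forall s w, s \in S -> w \in <<S>> ->
     length S (s * w) = (length S w).+1 -> P w -> P (s * w)) ->
  {in <<S>>, forall w, P w}.
Proof.
move=> P1 PM w; have [n] := ubnP (length S w).
elim: n => // n IHn in w * => lt_w_n Sw.
have := mem_length Sw; case Dk: (length S w) lt_w_n => [|k] lt_k_n.
  by rewrite expg0 => /set1P->.
rewrite expgS => /mulsgP[s v Ss Skv Dw].
have Sv := prod_gen Skv; have le_v_k := length_min Skv.
have := lengthM (mem_gen Ss) Sv; rewrite -Dw Dk => le_k.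
have le_s1: length S s <= 1 by rewrite length_min // expg1.
rewrite Dw; apply: PM => //; last by apply: IHn => //; length_lia.
by rewrite -Dw Dk; length_lia.
Qed.

(** Each cover adds exactly one letter, so lengths add along a chain; conversely, a shortest word
    for [u^-1 * v] spells out a chain of covers from [u] to [v]. *)
Lemma weak_leE : {in <<S>> &, forall u v,
  weak_le S u v = (length S u + length S (u^-1 * v) == length S v)}.
Proof.
move=> u v Su Sv; apply/idP/eqP=> [/connectP[p] | ].
  elim: p u Su => [|x p IHp] u Su /=; first by move=> _ ->; rewrite mulVg length1 addn0.
  case/andP=> /andP[/exists_inP[s Ss /eqP Dx] lt_ux] /IHp{}IHp Dv.
  have Ss' := mem_gen Ss; have Sx: x \in <<S>> by rewrite Dx groupM.
  have{IHp Dv} Dv := IHp Sx Dv.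
  have le_s1: length S s <= 1 by rewrite length_min // expg1.
  have := lengthM Su (groupM (groupVr Su) Sv); rewrite mulKVg.
  have := lengthM Ss' (groupM (groupVr Sx) Sv).
  have := lengthM Su Ss'; rewrite -Dx.
  have ->: s * (x^-1 * v) = u^-1 * v by rewrite Dx invMg !mulgA mulgV mul1g.
  by length_lia.
have [w Sw ->]: exists2 w, w \in <<S>> & v = u * w.
  by exists (u^-1 * v); rewrite ?mulKVg ?groupM ?groupV.
rewrite mulKg; elim/length_word_ind: w / Sw => [|s w Ss Sw lt_w IHw] in u Su {v Sv} *.
  by rewrite mulg1 => _; exact: connect0.
have Ss' := mem_gen Ss.
have le_s1: length S s <= 1 by rewrite length_min // expg1.
rewrite mulgA lt_w => Duw.
have := lengthM (groupM Su Ss') Sw; have := lengthM Su Ss' => le1 le2.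
apply: connect_trans (IHw _ (groupM Su Ss') _); last by length_lia.
apply/connect1/andP; split; last by length_lia.
by apply/exists_inP; exists s.
Qed.

Lemma weak_le_refl u : weak_le S u u.
Proof. exact: connect0. Qed.

Lemma weak_le_trans : transitive (weak_le S).
Proof. exact: connect_trans. Qed.

Lemma weak_le_anti u v : u \in <<S>> -> v \in <<S>> ->
  weak_le S u v -> weak_le S v u -> u = v.
Proof.
move=> Su Sv; rewrite !weak_leE // => /eqP le_uv /eqP le_vu.
apply/eqP; rewrite eq_mulVg1; apply: contraT => /length_gt0.
by rewrite groupM ?groupV //; length_lia.
Qed.

Lemma weak_le1 u : u \in <<S>> -> weak_le S 1 u.
Proof. by move=> Su; rewrite weak_leE ?group1 // length1 invg1 mul1g. Qed.

Lemma exists_gen_le u : u \in <<S>> -> u != 1 -> exists2 s, s \in S & weak_le S s u.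
Proof.
move=> Su; elim/length_word_ind: u / Su => [|s w Ss Sw lt_w _ _]; first by rewrite eqxx.
exists s => //; have Ss' := mem_gen Ss; rewrite weak_leE ?groupM // mulKg lt_w.
have := lengthM Ss' Sw; rewrite lt_w eqn_leq.
have le_s1: length S s <= 1 by rewrite length_min // expg1.
by length_lia.
Qed.

(** The lengths of [u] and [u^-1 * s] add up to at most 1, so one of the two is trivial. *)
Lemma weak_le_gen s u : s \in S -> u \in <<S>> -> weak_le S u s -> u = 1 \/ u = s.
Proof.
move=> Ss Su; have Ss' := mem_gen Ss; rewrite weak_leE // => /eqP Ds.
have le_s1: length S s <= 1 by rewrite length_min // expg1.
have [|/(length_gt0 Su) u_gt0] := eqVneq u 1; first by left.
right; apply/eqP; rewrite eq_mulVg1; apply: contraT => /length_gt0.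
by rewrite groupM ?groupV //; length_lia.
Qed.

Lemma meet_gen r s : r \in S -> s \in S -> r != s ->
  is_meet <<S>> (weak_le S) r s 1.
Proof.
move=> Sr Ss r_neq_s; split; rewrite ?group1 ?weak_le1 ?mem_gen // => u Su.
case/(weak_le_gen Sr Su) => -> //; first by rewrite weak_le_refl.
case/(weak_le_gen Ss (mem_gen Sr)) => [->|Drs]; first by rewrite weak_le_refl.
by rewrite Drs eqxx in r_neq_s.
Qed.

Lemma is_minimum_weak b : is_minimum <<S>> (weak_le S) b = (b == 1).
Proof.
apply/andP/eqP=> [[Sb /forall_inP min_b] | ->].
  by apply: weak_le_anti; rewrite ?group1 ?weak_le1 ?min_b ?group1.
by split; rewrite ?group1 //; apply/forall_inP=> u; apply: weak_le1.
Qed.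

Lemma atoms_weak : 1 \notin S -> atoms <<S>> (weak_le S) = S.
Proof.
move=> S'1; apply/setP=> a; rewrite inE; apply/andP/idP.
  case=> Sa /existsP[b]; rewrite is_minimum_weak => /andP[/eqP->].
  case/and5P=> _ _ a_neq1 le_1a /forall_inP cov_a.
  rewrite eq_sym in a_neq1; have [s Ss le_sa] := exists_gen_le Sa a_neq1.
  have /implyP := cov_a s (mem_gen Ss); rewrite weak_le1 ?mem_gen // => /(_ le_sa).
  by case/orP=> /eqP Ds; [rewrite -Ds Ss in S'1 | rewrite -Ds].
move=> Sa; have Sa' := mem_gen Sa; split=> //.
apply/existsP; exists 1; rewrite is_minimum_weak eqxx /covers group1 Sa' weak_le1 //=.
rewrite eq_sym (memPn S'1) //=; apply/forall_inP=> z Sz; apply/implyP=> /andP[_].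
by case/(weak_le_gen Sa Sz) => ->; rewrite eqxx ?orbT.
Qed.

End WordLength.

(* [n w x] is the parity of the number of occurrences of [x] in the sequence of
   reflections s_1 .. s_(i-1) s_i s_(i-1) .. s_1 attached to any word s_1 .. s_k
   for [w].  That it depends on [w] only is what the presentation provides, by
   way of the action of [W] on signed reflections. *)
Definition inversion_cocycle (gT : finGroupType) (S : {set gT}) (n : gT -> gT -> bool) :=
  [/\ {in S, forall s, s * s = 1},
      {in S, forall s x, n s x = (x == s)}
    & {in <<S>> &, forall u v x, n (u * v) x = n u x (+) n v (x ^ u)}].

(** * The cocycle obtained from the Coxeter presentation *)

Section SignedReflections.

Variable gT : finGroupType.
Implicit Types (s t x : gT) (p : gT * bool).

Definition signed_conj s p := (p.1 ^ s, p.2 (+) (p.1 == s)).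

Lemma signed_conj_inj s : injective (signed_conj s).
Proof. by move=> [x d] [y e] [/conjg_inj-> /addIb->]. Qed.

Definition signed_conj_perm s := perm (@signed_conj_inj s).

(** The reflections attached to the alternating word [s t s t ...] of length [k.*2] are the
    [(s * t) ^+ i * s]. *)
Lemma signed_conj_permX s t k x e : s * s = 1 -> t * t = 1 ->
  ((signed_conj_perm s * signed_conj_perm t) ^+ k) (x, e) =
  (x ^ ((s * t) ^+ k), e (+) \big[addb/false]_(0 <= i < k.*2) (x == (s * t) ^+ i * s)).
Proof.
move=> ss tt; have sV: s^-1 = s by apply/eqP; rewrite eq_invg_mul ss.
have tV: t^-1 = t by apply/eqP; rewrite eq_invg_mul tt.
have rV i: s * (s * t) ^- i = (s * t) ^+ i * s.
  elim: i => [|i IHi]; first by rewrite !expg0 invg1 mulg1 mul1g.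
  by rewrite {1}expgSr !invMg sV tV -mulgA IHi expgS !mulgA.
have conj_eq (z y w : gT) : (z ^ w == y) = (z == w * y * w^-1).
  by rewrite -{1}[y](conjgKV w) (inj_eq (@conjg_inj _ w)) conjgE invgK mulgA.
elim: k => [|k IHk]; first by rewrite big_geq // perm1 conjg1 addbF.
rewrite expgSr permM IHk permM !permE /signed_conj /= -!conjgM.
congr (_, _); first by rewrite -expgSr.
have ->: (x ^ (s * t) ^+ k == s) = (x == (s * t) ^+ k.*2 * s).
  by rewrite conj_eq -mulgA rV mulgA -expgD addnn.
have ->: (x ^ ((s * t) ^+ k * s) == t) = (x == (s * t) ^+ k.*2.+1 * s).
  by rewrite conj_eq invMg sV -!mulgA rV -addnn -addnS expgD expgS -!mulgA.
by rewrite doubleS !big_nat_recr //= -!addbA.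
Qed.

End SignedReflections.

Lemma coxeter_inversion_cocycle (gT : finGroupType) (W : {group gT}) (S : {set gT}) :
  coxeter_system W S -> exists n, inversion_cocycle S n.
Proof.
case=> m [[_ m1] <- rel_m univ].
have ss s: s \in S -> s * s = 1.
  by move=> Ss; have := rel_m s s Ss Ss; rewrite (eqP (etrans (m1 s s Ss Ss) (eqxx s))).
have [s t Ss St|phi [phiM phi_gen]] := univ _ (@signed_conj_perm gT).
  apply/permP=> -[x e]; rewrite signed_conj_permX ?ss // rel_m // conjg1 perm1.
  (* As [(s * t) ^+ m s t = 1], the second half of the list of reflections repeats the first, so the
     signs cancel. *)
  rewrite -addnn (@big_cat_nat _ _ _ (m s t)) ?leq_addr //=.
  rewrite -{2}[m s t]add0n big_addn addnK.
  rewrite [X in _ (+) (_ (+) X)](eq_bigr (fun i => x == (s * t) ^+ i * s)).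
    by rewrite addbb addbF.
  by move=> i _; rewrite expgD rel_m // mulg1.
have{}phiM u v x : u \in <<S>> -> v \in <<S>> -> phi (u * v) x = phi v (phi u x).
  by move=> Su Sv; rewrite (phiM u v Su Sv) -permM.
have phi1: phi 1 = 1.
  by apply/permP=> x; apply: (@perm_inj _ (phi 1)); rewrite -phiM ?group1 // mulg1 perm1.
have phi_genE s x e : s \in S -> phi s (x, e) = (x ^ s, e (+) (x == s)).
  by move=> Ss; rewrite phi_gen // permE.
(* The action commutes with flipping the sign, so the change of sign does not depend on the initial
   sign [e]. *)
have phiE w x e : w \in <<S>> -> phi w (x, e) = (x ^ w, e (+) (phi w (x, false)).2).
  move=> Sw; elim/length_word_ind: w / Sw => [|s w Ss Sw _ IHw] in x e *.
    by rewrite phi1 !perm1 conjg1 addbF.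
  have Ss' := mem_gen Ss.
  rewrite (phiM s w (x, e)) // (phiM s w (x, false)) // !(phi_genE s) //.
  by rewrite IHw [in RHS]IHw conjgM addbA.
exists (fun w x => (phi w (x, false)).2); split=> // [s Ss x|u v Su Sv x].
  by rewrite phi_genE.
by rewrite phiM // (phiE u) // (phiE v).
Qed.

(** * Exchange and descents from the cocycle *)

Section Parabolic.

Variables (gT : finGroupType) (S : {set gT}) (n : gT -> gT -> bool).
Hypothesis cocycle_n : inversion_cocycle S n.

Let gen_sq s : s \in S -> s * s = 1.
Proof. by case: cocycle_n => + _ _; apply. Qed.

Let inv_gen s x : s \in S -> n s x = (x == s).
Proof. by case: cocycle_n => _ + _ => /[apply]. Qed.

Let invM u v x : u \in <<S>> -> v \in <<S>> -> n (u * v) x = n u x (+) n v (x ^ u).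
Proof. by case: cocycle_n => _ _ + Su Sv; apply. Qed.

Lemma gen_inv s : s \in S -> s^-1 = s.
Proof. by move=> Ss; apply/eqP; rewrite eq_invg_mul gen_sq. Qed.

Lemma inversion1 x : n 1 x = false.
Proof. by have := @invM 1 1 x (group1 _) (group1 _); rewrite mulg1 conjg1 addbb. Qed.

Lemma one_notin_gen : 1 \notin S.
Proof. by apply/negP=> S1; have := inv_gen 1 S1; rewrite inversion1 eqxx. Qed.

Lemma lengthV w : w \in <<S>> -> length S w^-1 = length S w.
Proof.
have le_V u : u \in <<S>> -> length S u^-1 <= length S u.
  move=> Su; elim/length_word_ind: u / Su => [|s u Ss Su -> IHu]; first by rewrite invg1.
  have Ss' := mem_gen Ss; rewrite invMg (gen_inv Ss).
  have le_s1: length S s <= 1 by rewrite length_min // expg1.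
  by have := lengthM (groupVr Su) Ss'; length_lia.
by move=> Sw; apply/eqP; rewrite eqn_leq le_V // -{1}[w]invgK le_V ?groupV.
Qed.

Section Exchange.

Variable J : {set gT}.
Hypothesis sJS : J \subset S.

Lemma gen_subset w : w \in <<J>> -> w \in <<S>>.
Proof. exact/subsetP/genS. Qed.

(** Strong exchange: [x] is one of the reflections attached to the word, and multiplying by it
    deletes the matching letter. Words are taken in [J] so that the shortened word is again in
    [J]. *)
Lemma exchange k w x : w \in J ^+ k -> n w x ->
  exists2 j, k = j.+1 & x * w \in J ^+ j.
Proof.
elim: k w x => [|k IHk] w x; first by rewrite expg0 => /set1P->; rewrite inversion1.
rewrite expgS => /mulsgP[s v Js Jv ->]; have Ss := subsetP sJS s Js.
rewrite invM ?(mem_gen Ss) ?(gen_subset (prod_gen Jv)) // inv_gen //.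
have [-> _ | _ /(IHk _ _ Jv)[j -> Jxv]] := eqVneq x s.
  by exists k; rewrite // mulgA gen_sq // mul1g.
exists j.+1 => //; rewrite expgS.
have ->: x * (s * v) = s * (x ^ s * v) by rewrite conjgE !mulgA mulgV mul1g.
exact: mem_mulg.
Qed.

End Exchange.

Lemma inversion_lt w x : w \in <<S>> -> n w x -> length S (x * w) < length S w.
Proof.
move=> Sw /(exchange (subxx S) (mem_length Sw))[j -> Sxw].
by rewrite ltnS length_min.
Qed.

Lemma inversion_gen s w : s \in S -> w \in <<S>> -> n (s * w) s = ~~ n w s.
Proof.
move=> Ss Sw; rewrite invM ?(mem_gen Ss) // inv_gen // eqxx addTb.
by rewrite conjgE gen_sq // mulg1 gen_inv.
Qed.

(** If [s] is not an inversion of [w], it is one of [s * w], and exchange then makes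
    [w = s * (s * w)] the shorter element. *)
Lemma left_descentE s w : s \in S -> w \in <<S>> ->
  n w s = (length S (s * w) < length S w).
Proof.
move=> Ss Sw; apply/idP/idP=> [|lt_sw]; first exact: inversion_lt.
apply: contraLR lt_sw => n'ws; rewrite -leqNgt ltnW //.
have Ssw : s * w \in <<S>> by rewrite groupM ?(mem_gen Ss).
by have := @inversion_lt _ s Ssw; rewrite inversion_gen // mulgA gen_sq // mul1g => ->.
Qed.

Lemma gen_leE s w : s \in S -> w \in <<S>> -> weak_le S s w = n w s.
Proof.
move=> Ss Sw; have Ss' := mem_gen Ss.
rewrite weak_leE // left_descentE // (gen_inv Ss) (length_gen Ss) ?(memPn one_notin_gen) //.
apply/eqP/idP => [|lt_sw]; first by length_lia.
have := lengthM Ss' (groupM Ss' Sw); rewrite mulgA gen_sq // mul1g.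
by rewrite (length_gen Ss) ?(memPn one_notin_gen) //; length_lia.
Qed.

(** * Standard parabolic subgroups and minimal coset representatives *)

Section ParabolicSubgroup.

Variable J : {set gT}.
Hypothesis sJS : J \subset S.
Let J_S := subsetP sJS.
Let genJ_S := gen_subset sJS.

(** If the first letter of a shortest word in [J] did not increase the length over [S], exchange
    would shorten that word within [J]. *)
Lemma length_parabolic w : w \in <<J>> -> length J w = length S w.
Proof.
move=> Jw; apply/eqP; rewrite eqn_leq andbC; apply/andP; split.
  by rewrite length_min // (subsetP (subset_expg _ sJS)) // mem_length.
elim/length_word_ind: w / Jw => [|s w Js Jw lt_w IHw]; first by rewrite !length1.
have Ss := J_S Js; have Sw := genJ_S Jw.
have: n (s * w) s.
  rewrite inversion_gen //; apply/negP=> /(exchange sJS (mem_length Jw))[j Dj /length_min].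
  by rewrite lt_w Dj; lia.
rewrite left_descentE ?groupM ?(mem_gen Ss) // mulgA gen_sq // mul1g lt_w.
by length_lia.
Qed.

Lemma weak_le_parabolic : {in <<J>> &, weak_le J =2 weak_le S}.
Proof.
move=> u v Ju Jv; rewrite !weak_leE ?genJ_S //.
by rewrite !length_parabolic // groupM ?groupV.
Qed.

Lemma parabolic_ind (P : gT -> Prop) :
  P 1 ->
  (forall s w, s \in J -> w \in <<J>> -> n (s * w) s ->
     length S (s * w) = (length S w).+1 -> P w -> P (s * w)) ->
  {in <<J>>, forall w, P w}.
Proof.
move=> P1 PM w Jw; elim/length_word_ind: w / Jw => // s w Js Jw.
rewrite !length_parabolic ?groupM ?(mem_gen Js) // => lt_w; apply: PM => //.
have [Ss Sw] := (J_S Js, genJ_S Jw); have Ss' := mem_gen Ss.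
by rewrite left_descentE ?groupM // mulgA gen_sq // mul1g lt_w.
Qed.

(** Describes the right factors of the parabolic factorization, by additivity of length rather than
    by minimality in the coset. *)
Definition min_coset_rep m :=
  {in <<J>>, forall x, length S (x * m) = (length S x + length S m)%N}.

(** Since [s] is an inversion of [s * x], it could fail to be one of [s * x * m] only if its
    conjugate [s ^ (s * x)], an element of [<<J>>], were an inversion of [m]; multiplying by this
    conjugate would then shorten [m]. *)
Lemma min_coset_repP m : m \in <<S>> ->
  {in <<J>>, forall x, length S m <= length S (x * m)} -> min_coset_rep m.
Proof.
move=> Sm min_m x Jx; elim/parabolic_ind: x / Jx => [|s x Js Jx n_sx Dsx IHx].
  by rewrite mul1g length1.
have [Ss Sx] := (J_S Js, genJ_S Jx); have Ss' := mem_gen Ss.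
have := lengthM (groupM Ss' Sx) Sm; rewrite Dsx.
have: n (s * x * m) s.
  rewrite invM ?groupM // n_sx addTb; apply/negP=> /(inversion_lt Sm).
  by rewrite ltnNge min_m // groupJ ?groupM ?(mem_gen Js).
rewrite left_descentE ?groupM // !mulgA gen_sq // mul1g IHx.
by length_lia.
Qed.

Lemma parabolic_factor w : w \in <<S>> ->
  exists a m, [/\ a \in <<J>>, m \in <<S>>, w = a * m & min_coset_rep m].
Proof.
move=> Sw; have Jw: w \in <<J>> :* w by rewrite rcoset_refl.
case: (arg_minnP (length S) Jw) => m /rcosetP[a Ja Dm] min_m.
have Sm: m \in <<S>> by rewrite Dm groupM // genJ_S.
exists a^-1, m; split; rewrite ?groupV // ?Dm ?mulKg //.
rewrite -Dm; apply: min_coset_repP => // x Jx.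
by apply/min_m/rcosetP; exists (x * a); rewrite ?groupM // Dm mulgA.
Qed.

(** Cancelling [length m] shows that the chosen factor is below [a]; by maximality it is at least as
    long as [a], hence equal to it. *)
Lemma parabolic_mapE a m : a \in <<J>> -> m \in <<S>> -> min_coset_rep m ->
  parabolic_map S J (a * m) = a.
Proof.
move=> Ja Sm min_m; have [] := parabolic_mapP S J (a * m).
set p := parabolic_map _ _ _ => Jp; rewrite mulgA !min_m ?groupM ?groupV // => Dp.
move/(_ a Ja); rewrite mulKg => /(_ erefl) le_ap.
have [Sa Sp] := (genJ_S Ja, genJ_S Jp).
apply/eqP; rewrite eq_mulVg1; apply: contraT => /(@length_gt0 _ S).
by rewrite groupM ?groupV // => /(_ isT); length_lia.
Qed.

Lemma parabolic_map_mem w : parabolic_map S J w \in <<J>>.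
Proof. by case: (parabolic_mapP S J w). Qed.

Lemma parabolic_map_le w : w \in <<S>> -> weak_le S (parabolic_map S J w) w.
Proof.
move=> Sw; rewrite weak_leE ?(genJ_S (parabolic_map_mem w)) //; apply/eqP.
by case: (parabolic_mapP S J w) => _ ->.
Qed.

(** Together with [parabolic_map_le], this makes the image of [w] the largest element of [<<J>>]
    below [w]. With [w = a * m], the term [length m] cancels. *)
Lemma parabolic_map_max v w : v \in <<J>> -> w \in <<S>> -> weak_le S v w ->
  weak_le S v (parabolic_map S J w).
Proof.
move=> Jv /parabolic_factor[a [m [Ja Sm -> min_m]]]; have [Sv Sa] := (genJ_S Jv, genJ_S Ja).
rewrite parabolic_mapE // !weak_leE ?groupM // mulgA !min_m ?groupM ?groupV //.
by length_lia.
Qed.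

(** With [u = a * m], taking inverses shows that the route from [1] to [w] through [u] exceeds the
    one through [a] by twice [length m], so [m] is trivial. *)
Lemma parabolic_lower u w : u \in <<S>> -> w \in <<J>> -> weak_le S u w -> u \in <<J>>.
Proof.
case/parabolic_factor=> a [m [Ja Sm -> min_m]] Jw; have [Sa Sw] := (genJ_S Ja, genJ_S Jw).
have [-> | /(length_gt0 Sm) m_gt0] := eqVneq m 1; first by rewrite mulg1.
have Saw: a^-1 * w \in <<S>> by rewrite groupM ?groupV.
have Jwa: w^-1 * a \in <<J>> by rewrite groupM ?groupV.
have Swa := genJ_S Jwa.
have Daw: length S (a^-1 * w) = length S (w^-1 * a).
  by rewrite -[w in LHS]invgK -invMg lengthV.
have Dmw: length S ((a * m)^-1 * w) = (length S (w^-1 * a) + length S m)%N.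
  by rewrite -[w in LHS]invgK -invMg mulgA lengthV ?(groupM Swa Sm) ?min_m.
rewrite weak_leE ?(groupM Sa Sm) // Dmw min_m // => /eqP Dw.
by have := lengthM Sa Saw; rewrite mulKVg Daw; length_lia.
Qed.

(** Write [u = v * y]. As [s] is an inversion of [u] but not of [v], the cocycle makes [s ^ v] an
    inversion of [y]. Hence [(s * v)^-1 * u = s ^ v * y] is shorter than [y], and [s * v] is below
    [u]. *)
Lemma le_of_gens_le u v : u \in <<S>> -> {in J, forall s, weak_le S s u} ->
  v \in <<J>> -> weak_le S v u.
Proof.
move=> Su le_Ju Jv; elim/parabolic_ind: v / Jv => [|s v Js Jv n_sv Dsv].
  exact: weak_le1.
have [Ss Sv] := (J_S Js, genJ_S Jv); have Ss' := mem_gen Ss.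
have Sy: v^-1 * u \in <<S>> by rewrite groupM ?groupV.
rewrite !weak_leE ?groupM // => /eqP Du.
have := le_Ju s Js; rewrite gen_leE // -{1}(mulKVg v u) invM //.
rewrite inversion_gen // in n_sv; rewrite (negPf n_sv) => /(inversion_lt Sy).
have ->: s ^ v * (v^-1 * u) = (s * v)^-1 * u.
  by rewrite conjgE invMg (gen_inv Ss) -!mulgA mulKVg.
have := lengthM (groupM Ss' Sv) (groupM (groupVr (groupM Ss' Sv)) Su).
by rewrite mulKVg; length_lia.
Qed.

(** Every generator in [J] lies below an element of maximal length in [<<J>>], as otherwise it would
    lengthen that element. *)
Lemma parabolic_top : exists2 z, z \in <<J>> & {in <<J>>, forall v, weak_le S v z}.
Proof.
case: (arg_maxnP (length S) (group1 <<J>>)) => z Jz max_z.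
have Sz := genJ_S Jz; exists z => // v; apply: le_of_gens_le => // s Js.
have Ss := J_S Js; rewrite gen_leE //; apply: contraT => n'z.
have: n (s * z) s by rewrite inversion_gen.
rewrite left_descentE ?groupM ?(mem_gen Ss) // mulgA gen_sq // mul1g.
move=> lt_z; have := max_z _ (groupM (mem_gen Js) Jz).
by rewrite /= leqNgt lt_z.
Qed.

(** Common lower bounds stay in [<<J>>], which is a lower set. *)
Lemma parabolic_is_meet x y z : x \in <<J>> -> y \in <<J>> ->
  is_meet <<J>> (weak_le J) x y z -> is_meet <<S>> (weak_le S) x y z.
Proof.
move=> Jx Jy [Jz]; rewrite !weak_le_parabolic // => le_zx le_zy max_z.
split=> // [|u Su le_ux le_uy]; first exact: genJ_S.
have Ju := parabolic_lower Su Jx le_ux.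
by rewrite -weak_le_parabolic // max_z // weak_le_parabolic.
Qed.

(** The projection to [<<J>>] of an upper bound of [x] and [y] is still an upper bound. *)
Lemma parabolic_is_join x y z : x \in <<J>> -> y \in <<J>> ->
  is_join <<J>> (weak_le J) x y z -> is_join <<S>> (weak_le S) x y z.
Proof.
move=> Jx Jy [Jz]; rewrite !weak_le_parabolic // => le_xz le_yz min_z.
split=> // [|u Su le_xu le_yu]; first exact: genJ_S.
have Jp := parabolic_map_mem u.
apply: weak_le_trans (parabolic_map_le Su).
by rewrite -weak_le_parabolic // min_z // weak_le_parabolic // parabolic_map_max.
Qed.

End ParabolicSubgroup.

End Parabolic.

(** * Lattice homomorphisms and the factorization *)

Section LatticeHom.

Variables (T T' : finType) (A : {set T}) (le : rel T) (A' : {set T'}) (le' : rel T').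
Variable f : T -> T'.
Hypothesis hom_f : lattice_hom A le A' le' f.

(** When [x] is below [y], it is the meet of [x] and [y]. *)
Lemma lattice_hom_le x y : reflexive le -> x \in A -> y \in A -> le x y -> le' (f x) (f y).
Proof.
case: hom_f => _ meet_f _ le_refl Ax Ay le_xy.
by case: (meet_f x y Ax Ay x); first by split.
Qed.

End LatticeHom.

Theorem theorem1p5 (gT gT' : finGroupType)
    (W : {group gT}) (S : {set gT}) (W' : {group gT'}) (S' : {set gT'})
    (eta : gT -> gT') :
  coxeter_system W S -> coxeter_system W' S' ->
  lattice_hom W (weak_le S) W' (weak_le S') eta ->
  surjective_on W W' eta ->
  let J := [set s in S | eta s != 1] in
  {in W, forall w, eta w = eta (parabolic_map S J w)} /\
  compressive <<J>> (weak_le J) W' (weak_le S') eta.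
Proof.
move=> coxS coxS' hom_eta eta_onto J.
have [n cocS] := coxeter_inversion_cocycle coxS.
have [n' cocS'] := coxeter_inversion_cocycle coxS'.
have [genS genS'] : <<S>> = W /\ <<S'>> = W'.
  by split; [case: coxS => m [] | case: coxS' => m []].
rewrite -{}genS -{}genS' in hom_eta eta_onto *.
have [etaW eta_meet eta_join] := hom_eta.
have S'1 := one_notin_gen cocS; have S''1 := one_notin_gen cocS'.
have sJS: J \subset S by apply/subsetP=> s; rewrite inE => /andP[].
have J_S := subsetP sJS; have genJ_S := gen_subset sJS.
have eta_le x y : x \in <<S>> -> y \in <<S>> -> weak_le S x y ->
    weak_le S' (eta x) (eta y).
  exact: (lattice_hom_le hom_eta (@weak_le_refl _ S)).
have eta1 : eta 1 = 1.
  have: 1 \in eta @: <<S>> by rewrite eta_onto group1.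
  case/imsetP=> w Sw Dw; have Se1 := etaW 1 (group1 _).
  apply: (weak_le_anti Se1 (group1 _)); last exact: weak_le1.
  by rewrite Dw eta_le // weak_le1.
have [z Jz max_z] := parabolic_top cocS sJS; have Sz := genJ_S _ Jz.
have eta_top w : w \in <<S>> -> weak_le S' (eta w) (eta z).
  (* Only binary joins are known to be preserved, so generators are added one at a time: the top [x]
     of [<<K>>] is the join of [s] and the top [y] of [<<K :\ s>>]. *)
  have le_top k (K : {set gT}) : #|K| = k -> K \subset S ->
      {in <<K>>, forall u, weak_le S' (eta u) (eta z)}.
    elim: k K => [|k IHk] K cardK sKS u Ku.
      move: Ku; rewrite (cards0_eq cardK) gen0 => /set1P->.
      by rewrite eta1 weak_le1 ?etaW.
    have /card_gt0P[s Ks]: 0 < #|K| by rewrite cardK.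
    have Ss := subsetP sKS s Ks; have Ss' := mem_gen Ss.
    have sLK := subD1set K s; have sLS := subset_trans sLK sKS.
    have cardL: #|K :\ s| = k by apply/succn_inj; rewrite -cardK (cardsD1 s K) Ks.
    have [x Kx max_x] := parabolic_top cocS sKS.
    have [y Ly max_y] := parabolic_top cocS sLS.
    have [Sx Sy] := (gen_subset sKS Kx, gen_subset sLS Ly).
    apply: (weak_le_trans (eta_le u x (gen_subset sKS Ku) Sx (max_x u Ku))).
    have join_x: is_join <<S>> (weak_le S) y s x.
      split=> // [||v Sv le_yv le_sv]; last 1 first.
      - apply: (le_of_gens_le cocS sKS Sv _ Kx) => r Kr.
        have [-> // | r_neq_s] := eqVneq r s.
        by apply: weak_le_trans le_yv; rewrite max_y // mem_gen // !inE r_neq_s.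
      - by apply/max_x/(gen_subset sLK).
      exact/max_x/mem_gen.
    have [_ _ _] := eta_join y s Sy Ss' x join_x.
    apply; rewrite ?etaW //; first exact: IHk cardL sLS y Ly.
    have [Js | ] := boolP (s \in J); first by rewrite eta_le // max_z // mem_gen.
    by rewrite inE Ss negbK => /eqP->; rewrite weak_le1 ?etaW.
  by move=> Sw; apply: (le_top _ S erefl).
have eta_para w : w \in <<S>> -> eta w = eta (parabolic_map S J w).
  move=> Sw; set p := parabolic_map S J w.
  have Jp: p \in <<J>> by apply: parabolic_map_mem.
  have le_pw: weak_le S p w by apply: (parabolic_map_le sJS).
  have Sp := genJ_S p Jp.
  (* An element below [z] lies in [<<J>>], so if it is also below [w] it is below the projection
     [p]. *)
  have meet_p: is_meet <<S>> (weak_le S) w z p.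
    split=> // [|u Su le_uw le_uz]; first exact: max_z.
    by apply: (parabolic_map_max cocS) => //; apply: (parabolic_lower cocS sJS) Jz le_uz.
  have [_ _ _ max_p] := eta_meet w z Sw Sz p meet_p.
  have [Ew Ep] := (etaW w Sw, etaW p Sp).
  apply: (weak_le_anti Ew Ep); last exact: eta_le.
  by rewrite max_p ?weak_le_refl ?eta_top.
have meet_J r s : r \in J -> s \in J -> weak_le S' (eta r) (eta s) -> r = s.
  move=> Jr Js le_rs; have [Sr Ss] := (J_S _ Jr, J_S _ Js).
  apply: contraTeq (Jr) => r_neq_s; rewrite inE negb_and negbK; apply/orP; right.
  have [_ _ _ max1] := eta_meet r s (mem_gen Sr) (mem_gen Ss) 1 (meet_gen Sr Ss r_neq_s).
  have Er := etaW r (mem_gen Sr); have := max1 _ Er (weak_le_refl _ _) le_rs.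
  by rewrite eta1 => le_r1; apply/eqP/(weak_le_anti Er (group1 _) le_r1)/weak_le1.
(* By [eta_para], [s'] has a preimage [p] in [<<J>>]. For a generator [s] in [J] below [p], the
   image [eta s] is nontrivial and below [s'], hence equal to it. *)
have gens_J s' : s' \in S' -> exists2 s, s \in J & eta s = s'.
  move=> S's'; have: s' \in eta @: <<S>> by rewrite eta_onto mem_gen.
  case/imsetP=> w Sw; rewrite eta_para //; set p := parabolic_map S J w => Ds'.
  have Jp: p \in <<J>> by apply: parabolic_map_mem.
  have p_neq1: p != 1 by apply: contraNneq S''1 => p1; rewrite -eta1 -p1 -Ds'.
  have [s Js] := exists_gen_le Jp p_neq1; have Js' := mem_gen Js.
  rewrite (weak_le_parabolic cocS sJS) // => le_sp; exists s => //.
  have: weak_le S' (eta s) s' by rewrite Ds' eta_le ?genJ_S.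
  case/weak_le_gen => //; first by rewrite etaW ?genJ_S.
  by move/eqP; have:= Js; rewrite inE => /andP[_ /negPf->].
split; first exact: eta_para.
rewrite /compressive !atoms_weak //; last by apply: contra S'1; apply: J_S.
split.
- split=> [x Jx | x y Jx Jy v | x y Jx Jy v]; first by rewrite etaW ?genJ_S.
    by move/(parabolic_is_meet cocS sJS Jx Jy); apply: eta_meet; apply: genJ_S.
  by move/(parabolic_is_join cocS sJS Jx Jy); apply: eta_join; apply: genJ_S.
- apply/setP=> w'; rewrite -eta_onto; apply/imsetP/imsetP=> -[w].
    by move=> Jw ->; exists w; rewrite ?genJ_S.
  move=> Sw ->; exists (parabolic_map S J w); last exact: eta_para.
  exact: parabolic_map_mem.
- by move=> r s Jr Js Drs; apply: meet_J; rewrite // Drs weak_le_refl.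
apply/setP=> s'; apply/imsetP/idP=> [[s Js ->] | /gens_J[s Js <-]]; last by exists s.
(* Being nontrivial, [eta s] lies above some [t'] in [S'], and [t' = eta t] with [t] in [J];
   incomparability of the images forces [t = s]. *)
have Ss := J_S s Js; have Es := etaW s (mem_gen Ss).
have /(exists_gen_le Es)[t' S't' le_ts]: eta s != 1 by have:= Js; rewrite inE => /andP[].
have [t Jt Dt] := gens_J t' S't'.
by rewrite -(meet_J t s) // Dt.
Qed.
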